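(* For every countably infinite forest $T$, $\mathrm{Rd}_2(T)\geq 1/2$; that is, every 2-coloring of the edges of $K_\mathbb{N}$ contains, for every $\varepsilon>0$, a monochromatic copy of $T$ whose vertex set has upper density at least $1/2-\varepsilon$.
   Context: $K_{\mathbb{N}}$ is the complete graph on $\mathbb{N}=\{1,2,\dots\}$. A copy of $T$ is a subgraph of $K_\mathbb{N}$ isomorphic to $T$; monochromatic means all its edges have the same color. $\overline{d}(V)=\limsup_{t\to\infty}|V\cap\{1,\dots,t\}|/t$. For a 2-coloring $\varphi$, $\mathrm{Rd}_\varphi(T)$ is the supremum of $\overline{d}(V(T'))$ over monochromatic copies $T'$ of $T$, and $\mathrm{Rd}_2(T)=\inf_\varphi \mathrm{Rd}_\varphi(T)$. *)

(* Defs.v *)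
From Stdlib Require Import Reals List Classical ClassicalDescription.
From Coquelicot Require Import Coquelicot.
Open Scope R_scope.

Definition is_simple_graph {V : Type} (adj : V -> V -> Prop) : Prop :=
  (forall x y, adj x y -> adj y x) /\ (forall x, ~ adj x x).

Fixpoint path_adj {V : Type} (adj : V -> V -> Prop) (x : V) (l : list V) : Prop :=
  match l with
  | nil => True
  | y :: l' => adj x y /\ path_adj adj y l'
  end.

Definition has_cycle {V : Type} (adj : V -> V -> Prop) : Prop :=
  exists (v0 : V) (l : list V),
    (2 <= length l)%nat /\ NoDup (v0 :: l) /\ path_adj adj v0 l /\
    adj (last l v0) v0.

Definition is_forest {V : Type} (adj : V -> V -> Prop) : Prop :=
  is_simple_graph adj /\ ~ has_cycle adj.

Definition countably_infinite (V : Type) : Prop :=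
  exists g : nat -> V, (forall m n, g m = g n -> m = n) /\ (forall v, exists n, g n = v).

Fixpoint count_upto (A : nat -> Prop) (t : nat) : nat :=
  match t with
  | O => O
  | S t' => (count_upto A t' +
             (if excluded_middle_informative (A t) then 1 else 0))%nat
  end.

Definition upper_density (A : nat -> Prop) : Rbar :=
  LimSup_seq (fun n => INR (count_upto A (S n)) / INR (S n)).

(* A 2-colouring of the edges of K_N (N = {1,2,...}) is a symmetric
   c : nat -> nat -> bool; only values on distinct positive x, y matter. *)
Definition symmetric_colouring (c : nat -> nat -> bool) : Prop :=
  forall x y, c x y = c y x.

(* f embeds T = (V, adj) into K_N: the image subgraph (vertices f(V),
   edges {f u, f v} for adj u v) is a copy of T, all of whose edges get colour b. *)
Definition mono_copy {V : Type} (adj : V -> V -> Prop)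
    (c : nat -> nat -> bool) (b : bool) (f : V -> nat) : Prop :=
  (forall u v, f u = f v -> u = v) /\
  (forall v, (1 <= f v)%nat) /\
  (forall u v, adj u v -> c (f u) (f v) = b).

Definition image_set {V : Type} (f : V -> nat) : nat -> Prop :=
  fun n => exists v, f v = n.

(* Main.v *)
Require Import Defs.
From Stdlib Require Import Reals Lra Lia List Arith Bool Classical ClassicalEpsilon ClassicalDescription Relations FinFun.
From Coquelicot Require Import Coquelicot.
Import ListNotations.
(** A forest on a countable vertex set is a subgraph of a rooted tree on the same
    set, so it suffices to treat trees. For a colour [y] let [core y] be the largest
    vertex set in which every vertex has infinitely many [y]-neighbours; all but
    finitely many vertices lie in the core of some colour, so one core has upper
    density at least 1/2.

    - If the tree has unbounded depth, a core may be assumed (up to finitely many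
      vertices and a change of colour) to stay connected after the removal of any
      finite set. A greedy embedding then covers it: an uncovered vertex is reached
      by a path, and the tree has a fresh branch of the length of this path.
    - If the depth is bounded, let [p] be a deepest vertex with infinitely many
      children; the proper descendants of [p] have finite degree. If infinitely many
      of these children are leaves, send [p] to a vertex [a] of a core such that the
      neighbourhood of [a] in that colour has upper density at least 1/2.
    - Otherwise take an infinite set [A] towards which every vertex [v] has a
      limiting colour [chi v]. If [p] is placed in a class [chi = y] that meets
      [core y], the whole class is covered in colour [y]: the descendants of [p] at
      even distance fill the class, those at odd distance go to [A]. Comparing the
      cores with such classes, one class of upper density at least 1/2 qualifies,
      except possibly when some core is empty. Then peeling off vertices of finite
      degree yields an [A] with a cofinite class. *)

Local Open Scope nat_scope.

(** * Finite and infinite sets of natural numbers *)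

Definition infinite (P : nat -> Prop) := forall l : list nat, exists n, P n /\ ~ In n l.
Definition finite (P : nat -> Prop) := exists l : list nat, forall n, P n -> In n l.

Lemma not_infinite (P : nat -> Prop) : ~ infinite P -> finite P.
Proof.
  intros H. apply not_all_ex_not in H. destruct H as [l Hl]. exists l.
  intros n Hn. apply NNPP. intro. apply Hl. exists n. auto.
Qed.

Lemma not_finite (P : nat -> Prop) : ~ finite P -> infinite P.
Proof. intros H. apply NNPP. intro. apply H, not_infinite, H0. Qed.

Lemma infinite_mono (P Q : nat -> Prop) :
  (forall n, P n -> Q n) -> infinite P -> infinite Q.
Proof. intros H HP l. destruct (HP l) as [n [? ?]]. exists n; auto. Qed.

Lemma finite_mono (P Q : nat -> Prop) :
  (forall n, P n -> Q n) -> finite Q -> finite P.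
Proof. intros H [l Hl]. exists l; auto. Qed.

Lemma finite_or (P Q : nat -> Prop) :
  finite P -> finite Q -> finite (fun n => P n \/ Q n).
Proof.
  intros [l Hl] [m Hm]. exists (l ++ m). intros n [H|H]; apply in_or_app; auto.
Qed.

Lemma finite_list (l : list nat) : finite (fun n => In n l).
Proof. exists l; auto. Qed.

Lemma infinite_remove (P Q : nat -> Prop) :
  infinite P -> finite (fun n => P n /\ ~ Q n) -> infinite (fun n => P n /\ Q n).
Proof.
  intros HP [l Hl] m. destruct (HP (l ++ m)) as [n [Hn Hi]]. exists n.
  rewrite in_app_iff in Hi. repeat split; auto.
  apply NNPP. intro. apply Hi. left. auto.
Qed.

Lemma infinite_split (P Q : nat -> Prop) :
  infinite P -> ~ infinite (fun n => P n /\ Q n) -> infinite (fun n => P n /\ ~ Q n).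
Proof.
  intros HP HQ. apply infinite_remove; auto.
  apply (finite_mono _ (fun n => P n /\ Q n)).
  - intros n [? ?]. split; auto. apply NNPP; auto.
  - apply not_infinite; auto.
Qed.

Lemma list_bound (l : list nat) : exists k, forall n, In n l -> n < k.
Proof.
  induction l as [|x l [k Hk]].
  - exists 0. intros n [].
  - exists (S (x + k)). intros n [<-|H]; [lia|]. specialize (Hk n H). lia.
Qed.

Lemma infinite_unbounded (P : nat -> Prop) :
  (forall k, exists n, k <= n /\ P n) -> infinite P.
Proof.
  intros H l. destruct (list_bound l) as [k Hk]. destruct (H k) as [n [Hn HP]].
  exists n. split; auto. intro Hi. specialize (Hk n Hi). lia.
Qed.

Lemma infinite_beyond (P : nat -> Prop) (k : nat) :
  infinite P -> exists n, k <= n /\ P n.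
Proof.
  intros H. destruct (H (seq 0 k)) as [n [HP Hn]]. exists n. split; auto.
  rewrite in_seq in Hn. lia.
Qed.

Lemma least_exists (P : nat -> Prop) :
  (exists n, P n) -> exists n, P n /\ forall m, P m -> n <= m.
Proof.
  intros [n Hn]. apply NNPP. intro H. revert Hn.
  induction n as [n IH] using (well_founded_induction lt_wf). intros Hn. apply H.
  exists n. split; auto. intros m Hm.
  destruct (le_lt_dec n m); auto. exfalso. eapply IH; eauto.
Qed.

Lemma choice_fun {X Y : Type} (R : X -> Y -> Prop) :
  (forall x, exists y, R x y) -> exists f, forall x, R x (f x).
Proof.
  intros H. exists (fun x => proj1_sig (constructive_indefinite_description _ (H x))).
  intro x. apply proj2_sig.
Qed.

(** Diagonalisation: pick [f n >= n] in [P n]. As the sets decrease, only the [f k] with [k < n] can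
    miss [P n]. *)
Lemma pseudo_intersection (P : nat -> nat -> Prop) :
  (forall n m, P (S n) m -> P n m) -> (forall n, infinite (P n)) ->
  exists A, infinite A /\ (forall a, A a -> P 0 a) /\
    forall n, finite (fun a => A a /\ ~ P n a).
Proof.
  intros Hd Hi.
  assert (Hm : forall k n m, n <= k -> P k m -> P n m).
  { intros k n m Hle; induction Hle; auto. }
  destruct (choice_fun (fun n a => n <= a /\ P n a)) as [f Hf].
  { intro n. apply infinite_beyond, Hi. }
  exists (fun m => exists n, m = f n). repeat split.
  - apply infinite_unbounded. intro k. exists (f k). split; [apply Hf|eauto].
  - intros a [n ->]. apply (Hm n); [lia|apply Hf].
  - intros n. exists (map f (seq 0 n)). intros a [[k ->] Hk].
    apply in_map, in_seq. split; [lia|]. apply NNPP. intro. apply Hk.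
    apply (Hm k); [lia|apply Hf].
Qed.

(** * Coloured neighbourhoods *)

Section Colouring.

Variable c : nat -> nat -> bool.
Hypothesis c_sym : forall x y, c x y = c y x.

Definition good (y : bool) (D : nat -> Prop) :=
  forall v, D v -> infinite (fun u => D u /\ c v u = y).

Definition core (y : bool) (v : nat) := exists D, good y D /\ D v.

Lemma core_good (y : bool) : good y (core y).
Proof.
  intros v [D [HD Hv]]. eapply infinite_mono; [|apply (HD v Hv)].
  intros u [Hu Hc]. split; auto. exists D; auto.
Qed.

(* An ultrafilter-free substitute for the colour of a vertex towards a
   nonprincipal ultrafilter containing [A]. *)
Definition cohesive (A : nat -> Prop) (chi : nat -> bool) (x : bool) :=
  infinite A /\ (forall a, A a -> chi a = x) /\
  forall v, finite (fun a => A a /\ c v a <> chi v).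

(** Ties go to [true]. On an infinite set the chosen colour occurs infinitely often. *)
Definition majority (S : nat -> Prop) (k : nat) : bool :=
  if excluded_middle_informative (infinite (fun m => S m /\ c k m = true))
  then true else false.

Fixpoint stage (S : nat -> Prop) (n : nat) : nat -> Prop :=
  match n with
  | 0 => S
  | Datatypes.S k => fun m => stage S k m /\ c k m = majority (stage S k) k
  end.

Lemma stage_infinite (S : nat -> Prop) (n : nat) : infinite S -> infinite (stage S n).
Proof.
  intros HS. induction n as [|n IH]; simpl; auto.
  unfold majority. destruct (excluded_middle_informative _) as [H|H]; auto.
  apply (infinite_split _ _ IH) in H. eapply infinite_mono; [|exact H].
  intros m [? Hm]. split; auto. now apply not_true_is_false.
Qed.

Lemma stage_mono (S : nat -> Prop) (k n m : nat) : n <= k -> stage S k m -> stage S n m.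
Proof.
  intros Hle; induction Hle; auto. intros [? ?]. auto.
Qed.

(** A pseudo-intersection of the stages gives every vertex a limiting colour. To make [chi] constant
    on [A] as well, all stages are first cut down to one value of [chi]. *)
Lemma cohesive_exists (S : nat -> Prop) :
  infinite S -> exists A chi x, cohesive A chi x /\ forall a, A a -> S a.
Proof.
  intros HS. set (chi k := majority (stage S k) k).
  assert (Hx : exists x, forall n, infinite (fun m => stage S n m /\ chi m = x)).
  { destruct (classic (forall n, infinite (fun m => stage S n m /\ chi m = true)))
      as [H|H]; [now exists true|].
    apply not_all_ex_not in H. destruct H as [n0 H]. exists false. intro n.
    (* If [true] dies out at stage [n0], it stays out, so [false] survives in stage [max n n0],
       which lies inside stage [n]. *)
    assert (H' := infinite_split _ (fun m => chi m = true) (stage_infinite S (max n n0) HS)).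
    eapply infinite_mono; [|apply H'].
    - intros m [Hm Hc]. split; [|now apply not_true_is_false].
      apply (stage_mono S (max n n0)); auto; lia.
    - intro Hi. apply H. eapply infinite_mono; [|exact Hi].
      intros m [Hm Hc]. split; auto. apply (stage_mono S (max n n0)); auto; lia. }
  destruct Hx as [x Hx].
  destruct (pseudo_intersection (fun n m => stage S n m /\ chi m = x)) as [A [HA [H0 Hf]]]; auto.
  { intros n m [[? ?] ?]; auto. }
  exists A, chi, x. split; [split; [auto|split]|].
  - intros a Ha. apply H0; auto.
  - intro v. eapply finite_mono; [|apply (Hf (Datatypes.S v))].
    intros a [Ha Hc]. split; auto. intros [[_ H] _]. apply Hc, H.
  - intros a Ha. apply (H0 a Ha).
Qed.

(** A vertex of limiting colour [x] sends this colour to almost all of [A], and [A] lies in the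
    class. *)
Lemma cohesive_class_good (A : nat -> Prop) (chi : nat -> bool) (x : bool) (B : nat -> Prop) :
  cohesive A chi x -> (forall a, A a -> B a) -> good x (fun v => chi v = x /\ B v).
Proof.
  intros [HA [Hx Hf]] HB v [Hv _].
  eapply infinite_mono; [|apply (infinite_remove A (fun a => c v a = chi v) HA (Hf v))].
  intros a [Ha Hc]. repeat split; auto. congruence.
Qed.

(** A cohesive set among the vertices outside both cores would itself be good, hence contained in a
    core. *)
Lemma cores_cofinite : finite (fun v => ~ core true v /\ ~ core false v).
Proof.
  apply NNPP. intro H. apply not_finite in H.
  destruct (cohesive_exists _ H) as [A [chi [x [HA HS]]]].
  assert (Hg := cohesive_class_good A chi x A HA (fun a h => h)).
  destruct HA as [Hi [Hx _]]. destruct (Hi nil) as [a [Ha _]].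
  assert (core x a) by (exists (fun v => chi v = x /\ A v); auto).
  destruct (HS a Ha). destruct x; auto.
Qed.

(* [dominating y K] starts a game in which, whatever finite set [L] is
   forbidden, a set [K'] avoiding [L] inside the [y]-neighbourhood of [K] can be
   chosen, until the neighbourhood of the current set is cofinite. *)
Inductive dominating (y : bool) : list nat -> Prop :=
| dominating_now K :
    finite (fun u => ~ exists k, In k K /\ c k u = y) -> dominating y K
| dominating_later K (next : list nat -> list nat) :
    (forall L u, In u (next L) -> ~ In u L /\ exists k, In k K /\ c k u = y) ->
    (forall L, dominating y (next L)) -> dominating y K.

(** The empty list has no neighbours, so each move leads to [nil] again and the game could never
    end. *)
Lemma not_dominating_nil (y : bool) : ~ dominating y nil.
Proof.
  intro H. remember nil as K eqn:E. induction H as [K [l Hl]|K next Hn _ IH]; subst.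
  - destruct (list_bound l) as [k Hk]. specialize (Hk k).
    assert (In k l) by (apply Hl; intros [? [[] _]]). specialize (Hk H). lia.
  - apply (IH nil). destruct (next nil) as [|u l] eqn:E; auto.
    destruct (Hn nil u) as [_ [k [[] _]]]. rewrite E. now left.
Qed.

(* The complement of the core, presented by peeling off vertices of finite degree. *)
Inductive peeled (y : bool) : nat -> Prop :=
| peel v (l : list nat) :
    (forall u, c v u = y -> ~ In u l -> peeled y u) -> peeled y v.

(** The unpeeled vertices form a good set: one with finitely many unpeeled neighbours would be
    peeled through their list. *)
Lemma peeled_of_not_core (y : bool) (v : nat) : ~ core y v -> peeled y v.
Proof.
  intro H. apply NNPP. intro Hp. apply H. exists (fun w => ~ peeled y w). split; auto.
  intros w Hw. apply NNPP. intro Hi. apply not_infinite in Hi. destruct Hi as [l Hl].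
  apply Hw, (peel y w l). intros u Hu Hn. apply NNPP. intro. apply Hn, Hl. auto.
Qed.

Lemma dominating_app (y : bool) (P : nat -> Prop) (K : list nat) :
  (forall u, P u -> forall A, dominating y (u :: A) -> dominating y A) ->
  forall A, (forall u, In u K -> P u) -> dominating y (K ++ A) -> dominating y A.
Proof.
  intros HP. induction K as [|k K IH]; simpl; intros A HK H; auto.
  apply IH; auto. apply (HP k); auto.
Qed.

Lemma dominating_perm (y : bool) (K K' : list nat) :
  (forall u, In u K -> In u K') -> dominating y K -> dominating y K'.
Proof.
  intros HK H. destruct H as [K Hf|K next Hn Hd].
  - apply dominating_now. eapply finite_mono; [|exact Hf]. intros u H [k [? ?]].
    apply H. exists k; auto.
  - apply (dominating_later y K' next); auto.
    intros L u Hu. destruct (Hn L u Hu) as [? [k [? ?]]]. split; auto. exists k; auto.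
Qed.

Lemma partition_list (P Q : nat -> Prop) (K : list nat) :
  (forall u, In u K -> P u \/ Q u) ->
  exists K1 K2, (forall u, In u K1 -> P u) /\ (forall u, In u K2 -> Q u /\ In u K) /\
    forall u, In u K -> In u (K1 ++ K2).
Proof.
  induction K as [|k K IH]; intro H.
  - exists nil, nil. repeat split; simpl in *; tauto.
  - destruct IH as [K1 [K2 [H1 [H2 H3]]]]; [intros; apply H; now right|].
    destruct (H k) as [Hk|Hk]; [now left| |].
    + exists (k :: K1), K2. split; [|split].
      * intros u [<-|Hu]; auto.
      * intros u Hu. destruct (H2 u Hu). split; auto. now right.
      * intros u [<-|Hu]; simpl; auto.
    + exists K1, (k :: K2). split; [|split]; auto.
      * intros u [<-|Hu]; [split; auto; now left|]. destruct (H2 u Hu). split; auto. now right.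
      * intros u [<-|Hu]; rewrite in_app_iff; simpl; auto.
        specialize (H3 u Hu). rewrite in_app_iff in H3. tauto.
Qed.

(** Here every vertex is peeled. If outside each finite set there were a finite set with cofinite
    [y]-neighbourhood, peeled vertices could be dropped from dominating lists until [nil] is
    dominating. So beyond some [L] every finite set has infinitely many common [negb y]-neighbours,
    and a diagonal argument gives [A]. *)
Lemma core_empty (y : bool) :
  (forall v, ~ core y v) ->
  exists A L, infinite A /\
    forall v, ~ In v L -> finite (fun a => A a /\ c v a <> negb y).
Proof.
  intro Hy.
  assert (HL : exists L, forall K, (forall k, In k K -> ~ In k L) ->
     infinite (fun u => ~ exists k, In k K /\ c k u = y)).
  { apply NNPP. intro HL.
    assert (Hs : forall L, exists K, (forall k, In k K -> ~ In k L) /\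
       finite (fun u => ~ exists k, In k K /\ c k u = y)).
    { intro L. apply NNPP. intro H. apply HL. exists L. intros K HK.
      apply not_finite. intro. apply H. exists K; auto. }
    assert (Hp : forall v, peeled y v -> forall A, dominating y (v :: A) -> dominating y A).
    { intros v Hv. induction Hv as [v l _ IH]. intros A HA.
      (* A move from [v :: A] always exists: if its neighbourhood is already cofinite, [Hs] supplies
         a dominating set inside it. *)
      assert (Hstep : forall L, exists K, (forall k, In k K -> ~ In k L /\
          exists a, In a (v :: A) /\ c a k = y) /\ dominating y K).
      { intro L. inversion HA as [K [m Hm]|K next Hn Hd]; subst.
        - destruct (Hs (m ++ L)) as [K [HK Hf]]. exists K. split.
          + intros k Hk. specialize (HK k Hk). rewrite in_app_iff in HK. split; [tauto|].
            apply NNPP. intro. apply HK. left. auto.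
          + now apply dominating_now.
        - exists (next L). split; auto. }
      destruct (choice_fun (fun L K2 => (forall u, In u K2 -> ~ In u L /\
          exists a, In a A /\ c a u = y) /\ dominating y K2)) as [next Hnext].
      (* With [l] forbidden too, the induction hypothesis discards all chosen neighbours of [v]; the
         remaining vertices are neighbours of [A]. *)
      { intro L. destruct (Hstep (l ++ L)) as [K [HK Hd]].
        destruct (partition_list (fun u => c v u = y /\ ~ In u l)
           (fun u => exists a, In a A /\ c a u = y) K) as [K1 [K2 [H1 [H2 H3]]]].
        { intros u Hu. destruct (HK u Hu) as [Hl [a [[<-|Ha] Hc]]].
          - left. split; auto. intro; apply Hl, in_or_app; auto.
          - right. exists a; auto. }
        exists K2. split.
        - intros u Hu. destruct (H2 u Hu) as [? HuK]. split; auto.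
          intro. destruct (HK u HuK) as [Hl _]. apply Hl, in_or_app; auto.
        - apply (dominating_app y (fun u => c v u = y /\ ~ In u l) K1).
          + intros u [? ?]. apply IH; auto.
          + auto.
          + eapply dominating_perm; [exact H3|exact Hd]. }
      apply (dominating_later y A next); intro L; apply Hnext. }
    destruct (Hs nil) as [K [_ HK]]. apply (not_dominating_nil y).
    apply (dominating_app y (peeled y) K Hp nil).
    - intros u _. apply peeled_of_not_core, Hy.
    - rewrite app_nil_r. now apply dominating_now. }
  destruct HL as [L HL].
  destruct (pseudo_intersection (fun n u => forall v, v < n -> ~ In v L -> c v u = negb y))
    as [A [HA [_ Hf]]].
  - intros n m H v Hv. apply H. lia.
  - intro n. eapply infinite_mono;
      [|apply (HL (filter (fun v => if in_dec Nat.eq_dec v L then false else true) (seq 0 n)))].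
    + intros u Hu v Hv HvL. destruct (c v u) eqn:E, y; auto; exfalso; apply Hu; exists v;
        rewrite filter_In, in_seq; destruct (in_dec _ v L); tauto || (repeat split; auto; lia).
    + intros k Hk. apply filter_In in Hk. destruct (in_dec _ k L); intuition discriminate.
  - exists A, L. split; auto. intros v Hv. eapply finite_mono; [|apply (Hf (S v))].
    intros a [Ha Hc]. split; auto.
Qed.

(** * Connectivity that survives the removal of finite sets *)

Definition joined (z : bool) (D : nat -> Prop) (K : list nat) (s t : nat) :=
  c s t = z /\ D s /\ D t /\ ~ In s K /\ ~ In t K.

Lemma joined_sym (z : bool) (D : nat -> Prop) (K : list nat) (s t : nat) :
  clos_refl_trans nat (joined z D K) s t -> clos_refl_trans nat (joined z D K) t s.
Proof.
  intro H. induction H as [s t [H1 [? [? [? ?]]]]| |]; [|apply rt_refl|eapply rt_trans; eauto].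
  apply rt_step. repeat split; auto. now rewrite c_sym.
Qed.

Definition robust (z : bool) (D : nat -> Prop) :=
  forall K u v, D u -> D v -> ~ In u K -> ~ In v K ->
    clos_refl_trans nat (joined z D K) u v.

(* If a finite set separates [D] in colour [x], the rest of [D] is complete
   multipartite with infinite parts in the other colour. *)
Lemma robust_exists (x : bool) (D : nat -> Prop) :
  good x D -> exists z D', good z D' /\ robust z D' /\ finite (fun v => D v /\ ~ D' v).
Proof.
  intro HD. destruct (classic (robust x D)) as [Hr|Hr].
  { exists x, D. repeat split; auto. exists nil. tauto. }
  unfold robust in Hr.
  apply not_all_ex_not in Hr. destruct Hr as [K0 Hr].
  apply not_all_ex_not in Hr. destruct Hr as [u0 Hr].
  apply not_all_ex_not in Hr. destruct Hr as [v0 Hr].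
  apply imply_to_and in Hr. destruct Hr as [Hu Hr].
  apply imply_to_and in Hr. destruct Hr as [Hv Hr].
  apply imply_to_and in Hr. destruct Hr as [Hu' Hr].
  apply imply_to_and in Hr. destruct Hr as [Hv' Hr].
  set (D' v := D v /\ ~ In v K0).
  set (E := clos_refl_trans nat (joined x D K0)) in *.
  (* Components are infinite, since only finitely many vertices were removed from a good set. *)
  assert (HE : forall w, D' w -> infinite (fun t => D' t /\ E w t)).
  { intros w [Hw Hw'] l. destruct (HD w Hw (K0 ++ l)) as [t [[Ht Hc] Hn]].
    rewrite in_app_iff in Hn. exists t. unfold D'. repeat split; try tauto.
    apply rt_step. repeat split; tauto. }
  assert (Hy : forall s t, D' s -> D' t -> ~ E s t -> c s t = negb x).
  { intros s t [? ?] [? ?] Hn. destruct (c s t) eqn:Ec, x; auto; exfalso; apply Hn, rt_step;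
      repeat split; auto. }
  (* The components of [u0] and [v0] differ and are infinite, and one of them does not contain
     [w]. *)
  assert (Hout : forall w, D' w -> infinite (fun t => D' t /\ ~ E w t)).
  { intros w Hw. destruct (classic (E w u0)) as [Hwu|Hwu].
    - eapply infinite_mono; [|apply (HE v0); split; auto].
      intros t [Ht Hvt]. split; auto. intro Hwt. apply Hr.
      apply rt_trans with w; [now apply joined_sym|]. apply rt_trans with t; auto.
      now apply joined_sym.
    - eapply infinite_mono; [|apply (HE u0); split; auto].
      intros t [Ht Hvt]. split; auto. intro Hwt. apply Hwu.
      apply rt_trans with t; auto. now apply joined_sym. }
  exists (negb x), D'. split; [|split].
  - intros w Hw. eapply infinite_mono; [|apply (Hout w Hw)]. intros t [? ?]. split; auto.
  - intros K u v HuD HvD HuK HvK.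
    (* Two vertices of one part are linked through a vertex of another part chosen outside [K]. *)
    destruct (classic (E u v)) as [Huv|Huv].
    + destruct (Hout u HuD K) as [w [[Hw Hn] HwK]].
      apply rt_trans with w; apply rt_step; repeat split; auto; try apply Hy; auto;
        try apply HuD; try apply HvD; try apply Hw.
      intro Hwv. apply Hn. apply rt_trans with v; auto. now apply joined_sym.
    + apply rt_step. repeat split; auto; try apply HuD; try apply HvD; try apply Hy; auto.
  - eapply finite_mono; [|apply (finite_list K0)].
    intros v [? H]. apply NNPP. intro. apply H. split; auto.
Qed.

End Colouring.

(** * Simple paths *)

Lemma last_cons {V : Type} (x d : V) (l : list V) : last (x :: l) d = last l x.
Proof.
  revert x d. induction l as [|y l IH]; intros x d; auto.
  change (last (y :: l) d = last (y :: l) x). now rewrite !IH.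
Qed.

Lemma simple_suffix {V : Type} (R : V -> V -> Prop) (u w : V) (l : list V) :
  In u (w :: l) -> NoDup (w :: l) -> path_adj R w l ->
  exists l', NoDup (u :: l') /\ path_adj R u l' /\ last l' u = last l w.
Proof.
  revert w. induction l as [|x l IH]; intros w Hu Hn Hp.
  - destruct Hu as [->|[]]. exists nil. auto.
  - destruct Hu as [->|Hu]; [exists (x :: l); auto|].
    destruct Hp as [_ Hp]. inversion Hn; subst.
    destruct (IH x Hu H2 Hp) as [l' [H3 [H4 H5]]]. exists l'. repeat split; auto.
    now rewrite last_cons.
Qed.

(** A step is put in front; if its start already occurs on the path, the path is cut there. *)
Lemma simple_path {V : Type} (R : V -> V -> Prop) (u v : V) :
  clos_refl_trans V R u v -> exists l, NoDup (u :: l) /\ path_adj R u l /\ last l u = v.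
Proof.
  intro H. apply clos_rt_rt1n in H. induction H as [u|u w v HR _ [l [H1 [H2 H3]]]].
  - exists nil. repeat split; simpl; auto. constructor; auto. constructor.
  - destruct (classic (In u (w :: l))) as [Hi|Hi].
    + destruct (simple_suffix R u w l Hi H1 H2) as [l' [? [? ?]]]. exists l'.
      repeat split; auto. congruence.
    + exists (w :: l). split; [constructor; auto|]. split; [split; auto|].
      now rewrite last_cons.
Qed.

(** * Embedding a rooted tree *)

Section Tree.

Variable c : nat -> nat -> bool.
Hypothesis c_sym : forall x y, c x y = c y x.

Variables (root : nat) (par dep : nat -> nat).
Hypothesis dep_root : dep root = 0.
Hypothesis dep_par : forall n, n <> root -> dep n = S (dep (par n)).

(** The value [par root] is arbitrary, hence the guard. *)
Definition child (s n : nat) := n <> root /\ par n = s.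

Definition tree_copy (y : bool) (C : nat -> Prop) :=
  exists f : nat -> nat, (forall m n, f m = f n -> m = n) /\
    (forall n, n <> root -> c (f n) (f (par n)) = y) /\
    forall m, C m -> exists n, f n = m.

(** * Finite partial copies and their limits *)

Definition dom (st : list (nat * nat)) (n : nat) := exists b, In (n, b) st.
Definition ran (st : list (nat * nat)) (b : nat) := exists n, In (n, b) st.

(** The domain need not be closed under [par], since some vertices are placed after their children;
    an edge counts once both ends are placed. *)
Definition partial_copy (y : bool) (st : list (nat * nat)) :=
  (forall n b b', In (n, b) st -> In (n, b') st -> b = b') /\
  (forall n n' b, In (n, b) st -> In (n', b) st -> n = n') /\
  (forall n b b', n <> root -> In (n, b) st -> In (par n, b') st -> c b b' = y).

Lemma dom_cons st n b k : dom ((n, b) :: st) k <-> k = n \/ dom st k.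
Proof.
  split.
  - intros [b' [H|H]]; [left; congruence|right; now exists b'].
  - intros [->|[b' H]]; [exists b; now left|exists b'; now right].
Qed.

Lemma ran_cons st n b k : ran ((n, b) :: st) k <-> k = b \/ ran st k.
Proof.
  split.
  - intros [b' [H|H]]; [left; congruence|right; now exists b'].
  - intros [->|[b' H]]; [exists n; now left|exists b'; now right].
Qed.

Lemma dom_incl st st' n : incl st st' -> dom st n -> dom st' n.
Proof. intros H [b Hb]. exists b; auto. Qed.

Lemma dom_map st n : dom st n -> In n (map fst st).
Proof. intros [b H]. now apply (in_map fst) in H. Qed.

Lemma ran_map st n : ran st n -> In n (map snd st).
Proof. intros [b H]. now apply (in_map snd) in H. Qed.

Lemma partial_copy_add y st n b :
  partial_copy y st -> ~ dom st n -> ~ ran st b ->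
  (forall b', n <> root -> In (par n, b') st -> c b b' = y) ->
  (forall k b', child n k -> In (k, b') st -> c b b' = y) ->
  partial_copy y ((n, b) :: st).
Proof.
  intros [H1 [H2 H3]] Hd Hr Hp Hc. repeat split.
  - intros k b1 b2 [E1|I1] [E2|I2].
    + congruence.
    + injection E1 as <- <-. exfalso. apply Hd. now exists b2.
    + injection E2 as <- <-. exfalso. apply Hd. now exists b1.
    + eauto.
  - intros k k' b1 [E1|I1] [E2|I2].
    + congruence.
    + injection E1 as <- <-. exfalso. apply Hr. now exists k'.
    + injection E2 as <- <-. exfalso. apply Hr. now exists k.
    + eauto.
  - intros k b1 b2 Hk [E1|I1] [E2|I2].
    + injection E1 as -> ->. injection E2 as E _. apply dep_par in Hk. rewrite <- E in Hk. lia.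
    + injection E1 as -> ->. auto.
    + injection E2 as -> ->. rewrite c_sym. apply (Hc k); auto. now split.
    + eauto.
Qed.

(** Step [n] puts [n] into the domain and, if [n] is in [C], also into the range. The union of the
    increasing stages is the copy. *)
Lemma copy_limit (Inv : list (nat * nat) -> Prop) (y : bool) (C : nat -> Prop) :
  (exists st, Inv st) ->
  (forall st, Inv st -> partial_copy y st) ->
  (forall st n, Inv st -> exists st', Inv st' /\ incl st st' /\ dom st' n) ->
  (forall st m, Inv st -> C m -> exists st', Inv st' /\ incl st st' /\ ran st' m) ->
  tree_copy y C.
Proof.
  intros [st0 H0] Hp Hd Hr.
  destruct (choice_fun (fun (x : list (nat * nat) * nat) st' => Inv (fst x) ->
     Inv st' /\ incl (fst x) st' /\ dom st' (snd x) /\ (C (snd x) -> ran st' (snd x))))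
    as [next Hnext].
  { intros [st k]. simpl. destruct (classic (Inv st)) as [Hi|Hi]; [|exists nil; tauto].
    destruct (Hd st k Hi) as [st1 [Hi1 [I1 D1]]].
    destruct (classic (C k)) as [Hk|Hk]; [|exists st1; tauto].
    destruct (Hr st1 k Hi1 Hk) as [st2 [Hi2 [I2 R2]]]. exists st2. intros _.
    repeat split; auto; [eapply incl_tran; eauto|eapply dom_incl; eauto]. }
  set (seqn := fix seqn n := match n with 0 => st0 | S k => next (seqn k, k) end).
  assert (Hi : forall n, Inv (seqn n)).
  { induction n; simpl; auto. now apply Hnext. }
  assert (Hm : forall n m, n <= m -> incl (seqn n) (seqn m)).
  { intros n m Hle; induction Hle; [apply incl_refl|].
    eapply incl_tran; [exact IHHle|]. apply (Hnext (seqn m, m)), Hi. }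
  destruct (choice_fun (fun n b => In (n, b) (seqn (S n)))) as [f Hf].
  { intro n. apply (Hnext (seqn n, n)), Hi. }
  assert (Hf' : forall n k, n < k -> In (n, f n) (seqn k)).
  { intros n k Hk. apply (Hm (S n)); auto. }
  exists f. repeat split.
  - intros m n E. destruct (Hp _ (Hi (S (m + n)))) as [_ [H _]].
    apply (H m n (f m)); [|rewrite E]; apply Hf'; lia.
  - intros n Hn. destruct (Hp _ (Hi (S (n + par n)))) as [_ [_ H]].
    apply (H n); auto; apply Hf'; lia.
  - intros m HC. destruct (Hnext (seqn m, m) (Hi m)) as [_ [_ [_ H]]].
    destruct (H HC) as [n Hn]. exists n. simpl in Hn.
    destruct (Hp _ (Hi (S (m + n)))) as [H1 _].
    apply (H1 n); [apply Hf'; lia|]. apply (Hm (S m)); [lia|exact Hn].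
Qed.

(* [N] is the set of tree vertices that are embedded greedily into [D]. *)
Definition greedy_copy (y : bool) (D N : nat -> Prop) (st : list (nat * nat)) :=
  partial_copy y st /\ dom st root /\
  forall n b, In (n, b) st -> N n -> D b /\ (n <> root -> dom st (par n)).

Lemma greedy_copy_add y D N st n b :
  greedy_copy y D N st -> partial_copy y ((n, b) :: st) ->
  (N n -> D b /\ (n <> root -> dom st (par n))) -> greedy_copy y D N ((n, b) :: st).
Proof.
  intros [H1 [H2 H3]] Hp Hn. split; auto. split; [apply dom_cons; auto|].
  intros k b' [E|Hk] HN.
  - injection E as <- <-. destruct (Hn HN). split; auto. intro. apply dom_cons; auto.
  - destruct (H3 k b' Hk HN). split; auto. intro. apply dom_cons; auto.
Qed.

(** The image of the parent has infinitely many [y]-neighbours in [D]. As no child of [n] is placed,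
    the edge to the parent is the only constraint. *)
Lemma greedy_copy_step y D N st n :
  good c y D -> greedy_copy y D N st -> ~ dom st n -> n <> root ->
  dom st (par n) -> N (par n) -> (forall k, child n k -> ~ dom st k) ->
  exists b, greedy_copy y D N ((n, b) :: st).
Proof.
  intros HD HG Hn Hr [a Ha] HN Hc. destruct (HG) as [[H1 [H2 H3]] [_ H4]].
  destruct (H4 _ _ Ha HN) as [HDa _].
  destruct (HD a HDa (map snd st)) as [b [[Hb Hab] Hi]]. exists b.
  apply greedy_copy_add; auto; [|intros _; split; auto; intros _; now exists a].
  apply partial_copy_add; auto.
  - split; auto.
  - intro Hran. now apply Hi, ran_map.
  - intros b' _ Hb'. rewrite (H1 _ _ _ Hb' Ha), c_sym. auto.
  - intros k b' Hk Hb'. exfalso. apply (Hc k Hk). now exists b'.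
Qed.

Lemma embed_greedily (Inv : list (nat * nat) -> Prop) (N : nat -> Prop) :
  (forall st, Inv st -> dom st root) ->
  (forall n, N n -> n <> root -> N (par n)) ->
  (forall st n, Inv st -> N n -> ~ dom st n -> n <> root -> dom st (par n) ->
     exists b, Inv ((n, b) :: st)) ->
  forall n st, Inv st -> N n -> exists st', Inv st' /\ incl st st' /\ dom st' n.
Proof.
  intros Hr HN Hs n st HI Hn. remember (dep n) as d eqn:E. revert n E Hn.
  induction d as [|d IH]; intros n E Hn.
  - assert (n = root) as ->; [|exists st; repeat split; auto; apply incl_refl].
    apply NNPP. intro H. apply dep_par in H. lia.
  - assert (Hnr : n <> root) by (intros ->; lia).
    destruct (IH (par n)) as [st1 [H1 [I1 D1]]]; auto.
    { apply dep_par in Hnr. lia. }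
    destruct (classic (dom st1 n)) as [Hd|Hd]; [exists st1; auto|].
    destruct (Hs st1 n H1 Hn Hd Hnr D1) as [b Hb]. exists ((n, b) :: st1).
    split; auto. split; [now apply incl_tl|]. apply dom_cons; auto.
Qed.

(** Climbs from [p] to the root: each parent goes to a [y]-neighbour of the image of its child, and
    [L] keeps it off the images already used. The depth bound shows that no proper descendant of [p]
    is placed. *)
Lemma embed_ancestors y D : good c y D -> forall p a L, D a -> ~ In a L ->
  exists st, greedy_copy y D (fun _ => True) st /\ In (p, a) st /\
    (forall n, dom st n -> dep n <= dep p) /\ forall b, ran st b -> ~ In b L.
Proof.
  intros HD p. remember (dep p) as d eqn:E. revert p E.
  induction d as [|d IH]; intros p E a L Ha HL.
  - assert (p = root) as ->.
    { apply NNPP. intro H. apply dep_par in H. lia. }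
    exists [(root, a)]. repeat split.
    + intros n b b' [E1|[]] [E2|[]]. congruence.
    + intros n b b' [E1|[]] [E2|[]]. congruence.
    + intros n b b' Hn [E1|[]]. congruence.
    + exists a. now left.
    + destruct H as [H|[]]. congruence.
    + destruct H as [H|[]]. congruence.
    + now left.
    + intros n [b [H|[]]]. injection H as <- <-. lia.
    + intros b [n [H|[]]]. congruence.
  - assert (Hp : p <> root) by (intros ->; lia).
    destruct (HD a Ha (a :: L)) as [a' [[Ha' Hc] Hi]].
    destruct (IH (par p)) with (a := a') (L := a :: L) as [st [H1 [H2 [H3 H4]]]]; auto.
    { apply dep_par in Hp. lia. }
    assert (Hdp : ~ dom st p). { intro H. apply H3 in H. lia. }
    exists ((p, a) :: st). destruct (H1) as [Hpc _]. split; [|split; [now left|split]].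
    + apply greedy_copy_add; auto.
      * apply partial_copy_add; auto.
        -- intro H. apply H4 in H. apply H. now left.
        -- intros b' _ Hb'. destruct Hpc as [Hf _]. rewrite (Hf _ _ _ Hb' H2). auto.
        -- intros k b' [Hk Ek] Hk'. exfalso. apply dep_par in Hk. rewrite Ek in Hk.
           assert (dep k <= d) by (apply H3; now exists b'). lia.
      * intros _. split; auto. intros _. now exists a'.
    + intros n Hn. apply dom_cons in Hn. destruct Hn as [->|Hn]; [lia|].
      apply H3 in Hn. lia.
    + intros b Hb. apply ran_cons in Hb. destruct Hb as [->|Hb]; auto.
      apply H4 in Hb. intro. apply Hb. now right.
Qed.

Lemma greedy_copy_weaken y D N st :
  greedy_copy y D (fun _ => True) st -> greedy_copy y D N st.
Proof. intros [H1 [H2 H3]]. split; auto. Qed.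

Lemma infinite_fresh (P : nat -> Prop) (st : list (nat * nat)) :
  infinite P -> exists b, P b /\ ~ ran st b.
Proof.
  intro H. destruct (H (map snd st)) as [b [Hb Hn]]. exists b. split; auto.
  intro. now apply Hn, ran_map.
Qed.

(** * Copies built around a vertex with infinitely many children *)

Definition leaf (n : nat) := forall k, ~ child n k.

Lemma copy_covering_star y D p a :
  good c y D -> D a -> infinite (fun k => child p k /\ leaf k) ->
  tree_copy y (fun m => c a m = y).
Proof.
  intros HD Ha Hp.
  set (N n := ~ (child p n /\ leaf n)).
  assert (HN : forall n, n <> root -> N (par n)).
  { intros n Hn [_ Hl]. apply (Hl n). now split. }
  set (Inv st := greedy_copy y D N st /\ In (p, a) st).
  assert (Hadd : forall st k b, Inv st -> ~ N k -> ~ dom st k -> ~ ran st b -> c a b = y ->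
    Inv ((k, b) :: st)).
  { intros st k b [HG Hpa] Hk Hd Hr Hab. apply NNPP in Hk. destruct Hk as [[Hkr Hkp] Hl].
    split; [|now right]. destruct (HG) as [Hpc _]. apply greedy_copy_add; auto.
    - apply partial_copy_add; auto.
      + intros b' _ Hb'. destruct Hpc as [Hf _]. rewrite Hkp in Hb'.
        rewrite (Hf _ _ _ Hb' Hpa), c_sym. auto.
      + intros j b' Hj. exfalso. apply (Hl j Hj).
    - intro HNk. exfalso. apply HNk. repeat split; auto. }
  apply (copy_limit Inv).
  - destruct (embed_ancestors y D HD p a nil) as [st [H1 [H2 _]]]; auto.
    exists st. split; auto. now apply greedy_copy_weaken.
  - intros st [[H _] _]. auto.
  - intros st n HI. destruct (classic (N n)) as [Hn|Hn].
    + apply (embed_greedily Inv N); auto.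
      * intros s [[_ [H _]] _]. auto.
      * intros s k [HG Hpa] HNk Hd Hr Hpd.
        destruct (greedy_copy_step y D N s k) as [b Hb]; auto.
        -- intros j Hj [b Hjb]. destruct HG as [_ [_ H]].
           destruct (classic (N j)) as [HNj|HNj].
           ++ destruct (H _ _ Hjb HNj) as [_ Hd']. apply Hd. destruct Hj as [Hj1 <-]. auto.
           ++ apply NNPP in HNj. destruct HNj as [[_ Ej] _]. destruct Hj as [_ Ej'].
              apply Hd. exists a. congruence.
        -- exists b. split; auto. now right.
    + destruct (classic (dom st n)) as [Hd|Hd]; [now exists st; split; [|split; [apply incl_refl|]]|].
      destruct (infinite_fresh _ st (HD a Ha)) as [b [[_ Hb] Hr]].
      exists ((n, b) :: st). split; [auto|split; [now apply incl_tl|]]. apply dom_cons; auto.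
  - intros st m HI Hm.
    destruct (classic (ran st m)) as [Hd|Hd]; [now exists st; split; [|split; [apply incl_refl|]]|].
    destruct (Hp (map fst st)) as [k [Hk Hkd]]. exists ((k, m) :: st).
    split; [|split; [now apply incl_tl|apply ran_cons; auto]].
    apply Hadd; auto.
    + intro H. apply Hkd, dom_map, H.
Qed.

Inductive descendant (p : nat) : nat -> Prop :=
| descendant_child n : child p n -> descendant p n
| descendant_step n k : descendant p n -> child n k -> descendant p k.

Lemma descendant_dep p n : descendant p n -> dep p < dep n.
Proof.
  induction 1 as [n [Hn <-]|n k _ IH [Hk <-]]; apply dep_par in Hn || apply dep_par in Hk; lia.
Qed.

Lemma descendant_par p n : descendant p n -> child p n \/ descendant p (par n).
Proof. intro H. inversion H as [k Hk|k j Hk [_ Hj]]; subst; auto. Qed.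

(* The proper descendants of [p] at even distance go to arbitrary places of [Y];
   those at odd distance are placed in [A], after all their neighbours. *)
Lemma copy_covering_bipartite y D Y A p a :
  good c y D -> D a -> Y a -> infinite Y -> infinite A ->
  (forall v, Y v -> finite (fun b => A b /\ c v b <> y)) ->
  (forall n, dep p < dep n -> finite (child n)) ->
  infinite (fun k => child p k /\ ~ leaf k) ->
  tree_copy y Y.
Proof.
  intros HD Da Ya HY HA HYA Hfin Hp.
  set (N n := ~ descendant p n).
  (* For descendants the sum of depths has the parity of the distance to [p]. *)
  set (ev n := Nat.even (dep n + dep p)).
  assert (Hev : forall n, n <> root -> ev n = negb (ev (par n))).
  { intros n Hn. unfold ev. rewrite (dep_par n Hn). simpl Nat.add.
    now rewrite Nat.even_succ, <- Nat.negb_even. }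
  assert (Hevp : ev p = true).
  { unfold ev. apply Nat.even_spec. exists (dep p). lia. }
  assert (HN : forall n, N n -> n <> root -> N (par n)).
  { intros n Hn Hr Hd. apply Hn. apply (descendant_step p (par n)); auto. now split. }
  (* The last clause lets an odd descendant in only after its parent and all its children. *)
  set (Inv st := greedy_copy y D N st /\ In (p, a) st /\
    (forall n b, In (n, b) st -> descendant p n -> ev n = true -> Y b) /\
    (forall n, dom st n -> descendant p n -> ev n = false ->
       dom st (par n) /\ forall k, child n k -> dom st k)).
  (* The tree neighbours of an even descendant are odd; had one been placed, [n] would be placed
     too. So [n] meets no constraint. *)
  assert (Heven : forall st n b, Inv st -> descendant p n -> ev n = true -> ~ dom st n ->
    ~ ran st b -> Y b -> Inv ((n, b) :: st)).
  { intros st n b [HG [Hpa [HE HO]]] Hn En Hd Hr HYb.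
    split; [|split; [now right|split]].
    - apply greedy_copy_add; auto; [|intro H; exfalso; apply (H Hn)].
      apply partial_copy_add; auto.
      + apply HG.
      + intros b' Hnr Hb'. exfalso. apply Hd. assert (En' := Hev n Hnr). rewrite En in En'.
        destruct (ev (par n)) eqn:Epar; try discriminate.
        apply (HO (par n)); [now exists b'| |auto|now split].
        destruct (descendant_par p n Hn) as [[_ E]|]; auto. congruence.
      + intros k b' Hk Hb'. exfalso. apply Hd. destruct (Hk) as [Hkr <-].
        destruct (HO k) as [Hd' _]; [now exists b'|now apply (descendant_step p (par k))| |exact Hd'].
        rewrite Hev, En; auto.
    - intros k b' [E|Hk]; [injection E as <- <-; auto|eauto].
    - intros k Hk Hdk Ek. apply dom_cons in Hk. destruct Hk as [->|Hk]; [congruence|].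
      destruct (HO k Hk Hdk Ek) as [H1 H2].
      split; [apply dom_cons; auto|intros j Hj; apply dom_cons; auto]. }
  assert (Hlist : forall l st, Inv st ->
    (forall n, In n l -> dom st n \/ descendant p n /\ ev n = true) ->
    exists st', Inv st' /\ incl st st' /\ forall n, In n l -> dom st' n).
  { induction l as [|n l IH]; intros st HI Hl.
    - exists st. split; auto. split; [apply incl_refl|]. intros n [].
    - destruct (IH st HI) as [st1 [HI1 [I1 D1]]]; [intros; apply Hl; now right|].
      destruct (classic (dom st1 n)) as [Hd|Hd].
      { exists st1. split; [auto|split; [auto|intros k [<-|Hk]; auto]]. }
      destruct (Hl n) as [Hn|[Hn En]]; [now left| |].
      { exfalso. apply Hd. eapply dom_incl; eauto. }
      destruct (infinite_fresh Y st1 HY) as [b [Hb Hr]].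
      exists ((n, b) :: st1). split; [now apply Heven|].
      split; [now apply incl_tl|]. intros k [<-|Hk]; apply dom_cons; auto. }
  (* Each vertex of [Y] is joined in colour [y] to almost all of [A], hence so are finitely many at
     once. *)
  assert (Hgen : forall st : list (nat * nat),
    infinite (fun b => A b /\ forall n v, In (n, v) st -> Y v -> c b v = y)).
  { induction st as [|[n v] st IH].
    - eapply infinite_mono; [|exact HA]. intros b Hb. split; auto. intros n v [].
    - destruct (classic (Y v)) as [Hv|Hv].
      + eapply infinite_mono; [|apply (infinite_remove _ (fun b => c v b = y) IH)].
        * intros b [[Hb H] Hc]. split; auto. intros k w [E|Hk]; [|eauto].
          injection E as <- <-. rewrite c_sym. auto.
        * eapply finite_mono; [|apply (HYA v Hv)]. intros b [[Hb _] Hc]. auto.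
      + eapply infinite_mono; [|exact IH]. intros b [Hb H]. split; auto.
        intros k w [E|Hk]; [|eauto]. injection E as <- <-. contradiction. }
  apply (copy_limit Inv).
  - destruct (embed_ancestors y D HD p a nil) as [st [H1 [H2 [H3 _]]]]; auto.
    assert (H4 : forall n, dom st n -> ~ descendant p n).
    { intros n Hn Hd. apply descendant_dep in Hd. apply H3 in Hn. lia. }
    exists st. split; [now apply greedy_copy_weaken|split; [auto|split]].
    + intros n b Hn Hd. exfalso. apply (H4 n); auto. now exists b.
    + intros n Hn Hd. exfalso. apply (H4 n); auto.
  - intros st [[H _] _]. auto.
  - intros st n HI. destruct (classic (N n)) as [Hn|Hn].
    + apply (embed_greedily Inv N); auto.
      * intros s [[_ [H _]] _]. auto.
      * intros s k [HG [Hpa [HE HO]]] HNk Hd Hr Hpd.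
        destruct (greedy_copy_step y D N s k) as [b Hb]; auto.
        -- intros j Hj [b Hjb]. destruct (classic (N j)) as [HNj|HNj].
           ++ destruct HG as [_ [_ H]]. destruct (H _ _ Hjb HNj) as [_ Hd'].
              apply Hd. destruct Hj as [Hj1 <-]. auto.
           ++ apply NNPP in HNj. destruct Hj as [Hj1 Ej].
              destruct (descendant_par p j HNj) as [[_ E]|Hdj].
              ** apply Hd. exists a. congruence.
              ** apply HNk. congruence.
        -- exists b. split; [auto|split; [now right|split]].
           ++ intros j b' [E|Hj] Hdj; [injection E as <- <-; contradiction|eauto].
           ++ intros j Hj Hdj Ej. apply dom_cons in Hj.
              destruct Hj as [->|Hj]; [contradiction|].
              destruct (HO j Hj Hdj Ej). split; [apply dom_cons; auto|].
              intros i Hi. apply dom_cons; auto.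
    + apply NNPP in Hn.
      assert (Hnr : n <> root).
      { intros ->. apply descendant_dep in Hn. lia. }
      destruct (classic (dom st n)) as [Hd|Hd].
      { exists st. split; [auto|split; [apply incl_refl|auto]]. }
      destruct (ev n) eqn:En.
      * destruct (Hlist [n] st HI) as [st' [H1 [H2 H3]]].
        { intros k [<-|[]]. auto. }
        exists st'. split; [auto|split; [auto|apply H3; now left]].
      (* Being below [p], the odd vertex [n] has finitely many children. They and the parent are
         placed first, then [n] goes to [A]. *)
      * destruct (Hfin n) as [l Hl]; [now apply descendant_dep|].
        assert (Epar : ev (par n) = true).
        { specialize (Hev n Hnr). destruct (ev (par n)); simpl in Hev; congruence. }
        assert (Hpar : par n = p \/ descendant p (par n)).
        { destruct (descendant_par p n Hn) as [[_ E]|]; auto. }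
        destruct (Hlist (par n :: filter (fun k =>
           if excluded_middle_informative (child n k) then true else false) l) st HI)
          as [st1 [HI1 [I1 D1]]].
        { intros k [<-|Hk].
          - destruct Hpar as [->|Hpar]; [|auto]. left. exists a. apply HI.
          - apply filter_In in Hk. destruct Hk as [_ Hk].
            destruct (excluded_middle_informative (child n k)) as [Hc|]; [|discriminate].
            right. split; [now apply (descendant_step p n)|]. destruct Hc as [Hk1 <-].
            rewrite Hev, En; auto. }
        assert (Hch : forall k, child n k -> dom st1 k).
        { intros k Hk. apply D1. right. apply filter_In. split; auto.
          destruct (excluded_middle_informative (child n k)); tauto. }
        destruct (classic (dom st1 n)) as [Hd1|Hd1]; [exists st1; auto|].
        destruct (infinite_fresh _ st1 (Hgen st1)) as [b [[Hb HbY] Hr]].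
        destruct (HI1) as [HG [Hpa [HE HO]]].
        exists ((n, b) :: st1).
        split; [|split; [now apply incl_tl|apply dom_cons; auto]].
        split; [|split; [now right|split]].
        -- apply greedy_copy_add; auto; [|intro H; exfalso; apply (H Hn)].
           apply partial_copy_add; auto.
           ++ apply HG.
           ++ intros b' _ Hb'. apply (HbY (par n)); auto.
              destruct Hpar as [E|Hpar]; [|eauto].
              destruct HG as [[Hf _] _]. rewrite E in Hb'. now rewrite (Hf _ _ _ Hb' Hpa).
           ++ intros k b' Hk Hb'. apply (HbY k); auto. apply (HE k); auto.
              ** now apply (descendant_step p n).
              ** destruct Hk as [Hk1 <-]. rewrite Hev, En; auto.
        -- intros k b' [E|Hk] Hdk Ek; [injection E as <- <-; congruence|eauto].
        -- intros k Hk Hdk Ek. apply dom_cons in Hk. destruct Hk as [->|Hk].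
           ++ split; [apply dom_cons; right; apply D1; now left|].
              intros j Hj. apply dom_cons; auto.
           ++ destruct (HO k Hk Hdk Ek). split; [apply dom_cons; auto|].
              intros j Hj. apply dom_cons; auto.
  - intros st m HI Hm.
    destruct (classic (ran st m)) as [Hd|Hd].
    { exists st. split; [auto|split; [apply incl_refl|auto]]. }
    (* Take a non-leaf child [k] of [p] with no placed child; a child [j] of [k] is an even
       descendant free to go to [m]. *)
    destruct (Hp (map par (map fst st))) as [k [[Hk Hl] Hkd]].
    apply not_all_not_ex in Hl. destruct Hl as [j Hj].
    exists ((j, m) :: st). split; [|split; [now apply incl_tl|apply ran_cons; auto]].
    apply Heven; auto.
    + apply (descendant_step p k); auto. now constructor.
    + destruct Hj as [Hj <-]. destruct Hk as [Hk Ek].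
      rewrite (Hev j Hj), (Hev _ Hk), Ek, Hevp; auto.
    + intro H. apply Hkd. destruct Hj as [_ <-]. now apply in_map, dom_map.
Qed.

(** * Trees of unbounded depth *)

Lemma child_path_dep s l n : path_adj child s l -> In n l -> dep s < dep n.
Proof.
  revert s. induction l as [|t l IH]; intros s Hp Hn; [destruct Hn|].
  destruct Hp as [[Ht <-] Hp]. apply dep_par in Ht. destruct Hn as [<-|Hn]; [lia|].
  specialize (IH t Hp Hn). lia.
Qed.

Lemma path_adj_firstn {V : Type} (R : V -> V -> Prop) s l n :
  path_adj R s l -> path_adj R s (firstn n l).
Proof.
  revert s n. induction l as [|t l IH]; intros s [|n]; simpl; auto. intros [? ?]. auto.
Qed.

Lemma path_adj_snoc {V : Type} (R : V -> V -> Prop) s l x :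
  path_adj R s l -> R (last l s) x -> path_adj R s (l ++ [x]).
Proof.
  revert s. induction l as [|t l IH]; intros s; simpl path_adj.
  - auto.
  - rewrite last_cons. intros [? ?] ?. split; auto.
Qed.

Lemma ascend_to_dom st n :
  dom st root -> exists s l, dom st s /\ path_adj child s l /\ last l s = n /\
    (forall t, In t l -> ~ dom st t) /\ dep n = dep s + length l.
Proof.
  intro Hr. remember (dep n) as d eqn:E. revert n E. induction d as [|d IH]; intros n E.
  - assert (n = root) as ->.
    { apply NNPP. intro H. apply dep_par in H. lia. }
    exists root, nil. simpl. repeat split; auto; lia.
  - destruct (classic (dom st n)) as [Hd|Hd].
    { exists n, nil. simpl. repeat split; auto; lia. }
    assert (Hn : n <> root) by (intros ->; lia).
    destruct (IH (par n)) as [s [l [H1 [H2 [H3 [H4 H5]]]]]].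
    { apply dep_par in Hn. lia. }
    exists s, (l ++ [n]). split; [auto|split; [|split; [apply last_last|split]]].
    + apply path_adj_snoc; auto. rewrite H3. now split.
    + intros t Ht. apply in_app_iff in Ht. destruct Ht as [Ht|[<-|[]]]; auto.
    + rewrite length_app. simpl. lia.
Qed.

(** If the fresh branches at each of the finitely many placed vertices had bounded length, all
    depths would be bounded, since every vertex ends such a branch. *)
Lemma unbounded_branch st :
  (forall h, exists n, h <= dep n) -> dom st root ->
  exists s, dom st s /\ forall h, exists l,
    path_adj child s l /\ (forall t, In t l -> ~ dom st t) /\ length l = h.
Proof.
  intros Hu Hr. apply NNPP. intro Hno.
  assert (Hb : forall s, dom st s -> exists h, forall l, path_adj child s l ->
     (forall t, In t l -> ~ dom st t) -> length l < h).
  { intros s Hs. apply NNPP. intro H. apply Hno. exists s. split; auto. intro h.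
    apply NNPP. intro Hh. apply H. exists h. intros l Hl Hf.
    destruct (le_lt_dec h (length l)) as [Hle|]; auto. exfalso. apply Hh.
    exists (firstn h l). split; [now apply path_adj_firstn|split].
    - intros t Ht. apply Hf. rewrite <- (firstn_skipn h l). apply in_or_app; auto.
    - rewrite length_firstn. lia. }
  assert (HB : forall m, (forall s, In s m -> dom st s) -> exists h, forall s l, In s m ->
     path_adj child s l -> (forall t, In t l -> ~ dom st t) -> dep s + length l < h).
  { induction m as [|s m IH]; intro Hm.
    - exists 0. intros s l [].
    - destruct IH as [h Hh]; [intros; apply Hm; now right|].
      destruct (Hb s) as [h' Hh']; [apply Hm; now left|].
      exists (h + dep s + h'). intros t l [<-|Ht] Hl Hf.
      + specialize (Hh' l Hl Hf). lia.
      + specialize (Hh t l Ht Hl Hf). lia. }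
  destruct (HB (map fst st)) as [h Hh].
  { intros s Hs. apply in_map_iff in Hs. destruct Hs as [[k b] [<- Hk]]. now exists b. }
  destruct (Hu h) as [n Hn].
  destruct (ascend_to_dom st n Hr) as [s [l [H1 [H2 [_ [H4 H5]]]]]].
  specialize (Hh s l (dom_map _ _ H1) H2 H4). lia.
Qed.

(** The domain is closed under [par], so an unplaced vertex has no placed child and the branch [l]
    can be laid along [xs] vertex by vertex. *)
Lemma embed_path y D K : good c y D -> forall l xs st s b,
  greedy_copy y D (fun _ => True) st -> In (s, b) st ->
  path_adj child s l -> (forall t, In t l -> ~ dom st t) ->
  NoDup (b :: xs) -> path_adj (joined c y D K) b xs -> (forall x, In x xs -> ~ ran st x) ->
  length l = length xs ->
  exists st', greedy_copy y D (fun _ => True) st' /\ incl st st' /\ ran st' (last xs b).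
Proof.
  intro HD. induction l as [|t l IH]; intros [|x xs] st s b HG Hs Hl Hf Hn Hx Hr E;
    try discriminate E.
  { exists st. split; [auto|split; [apply incl_refl|now exists s]]. }
  destruct Hl as [Ht Hl]. destruct Hx as [[Hc [_ [Dx _]]] Hx].
  destruct (HG) as [Hpc [_ Hcl]].
  assert (Htd : ~ dom st t) by (apply Hf; now left).
  assert (HG1 : greedy_copy y D (fun _ => True) ((t, x) :: st)).
  { destruct Ht as [Htr Hts]. apply greedy_copy_add; auto.
    - apply partial_copy_add; auto.
      + apply Hr. now left.
      + intros b' _ Hb'. destruct Hpc as [Hfun _]. rewrite Hts in Hb'.
        rewrite (Hfun _ _ _ Hb' Hs), c_sym. auto.
      + intros k b' [Hk Ek] Hkb. exfalso. apply Htd. rewrite <- Ek.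
        apply (Hcl _ _ Hkb); auto.
    - intros _. split; auto. intros _. rewrite Hts. now exists b. }
  inversion Hn as [|? ? Hn1 Hn2]; subst. inversion Hn2 as [|? ? Hn3 Hn4]; subst.
  destruct (IH xs ((t, x) :: st) t x) as [st' [H1 [H2 H3]]]; auto.
  - now left.
  - intros k Hk Hd. apply dom_cons in Hd. destruct Hd as [->|Hd].
    + apply (child_path_dep t l t) in Hl; auto. lia.
    + apply (Hf k); auto. now right.
  - intros k Hk Hd. apply ran_cons in Hd. destruct Hd as [->|Hd]; auto.
    apply (Hr k); auto. now right.
  - exists st'. split; [auto|split].
    + intros e He. apply H2. now right.
    + now rewrite last_cons.
Qed.

Lemma path_joined_avoids y D K b xs x :
  path_adj (joined c y D K) b xs -> In x xs -> ~ In x K.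
Proof.
  revert b. induction xs as [|z xs IH]; intros b Hp Hx; [destruct Hx|].
  destruct Hp as [[_ [_ [_ [_ Hz]]]] Hp]. destruct Hx as [<-|Hx]; eauto.
Qed.

Lemma copy_covering_robust y D d :
  good c y D -> robust c y D -> D d -> (forall h, exists n, h <= dep n) -> tree_copy y D.
Proof.
  intros HD HR Dd Hu. apply (copy_limit (greedy_copy y D (fun _ => True))).
  - destruct (embed_ancestors y D HD root d nil) as [st [H _]]; auto. now exists st.
  - intros st H. apply H.
  - intros st n HI. apply (embed_greedily _ (fun _ => True)); auto.
    + intros s H. apply H.
    + intros s k HG _ Hd Hr Hpd.
      destruct (greedy_copy_step y D (fun _ => True) s k) as [b Hb]; auto.
      * intros j [Hj <-] [b Hjb]. apply Hd. apply HG in Hjb; auto. now apply Hjb.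
      * now exists b.
  - intros st m HI Dm. destruct (classic (ran st m)) as [Hm|Hm].
    { exists st. split; [auto|split; [apply incl_refl|auto]]. }
    destruct (unbounded_branch st Hu) as [s [[b Hs] Hbr]]; [apply HI|].
    (* All used vertices except [b] are removed, because the path to [m] starts at [b]. *)
    set (K := remove Nat.eq_dec b (map snd st)).
    assert (HK : forall x, ran st x -> x <> b -> In x K).
    { intros x Hx Hb. apply in_in_remove; auto. now apply ran_map. }
    assert (Db : D b) by (apply HI in Hs; [apply Hs|auto]).
    destruct (simple_path _ _ _ (HR K b m Db Dm (remove_In _ _ _)
       (fun H => Hm ltac:(apply in_remove in H; destruct H as [H _]; apply in_map_iff in H;
          destruct H as [[k v] [<- H]]; now exists k)))) as [xs [H1 [H2 H3]]].
    destruct (Hbr (length xs)) as [l [H4 [H5 H6]]]. rewrite <- H3.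
    apply (embed_path y D K HD l xs st s b); auto.
    intros x Hx Hrx. apply (path_joined_avoids y D K b xs x H2 Hx). apply HK; auto.
    intros ->. inversion H1; contradiction.
Qed.

(** If every vertex had finitely many children, each level and hence the whole tree would be
    finite. *)
Lemma last_infinite_branching h :
  (forall n, dep n <= h) ->
  exists p, infinite (child p) /\ forall n, dep p < dep n -> finite (child n).
Proof.
  intro Hh.
  assert (He : exists p, infinite (child p)).
  { apply NNPP. intro Hno.
    assert (Hc : forall p, finite (child p)).
    { intro p. apply not_infinite. intro. apply Hno. now exists p. }
    assert (Hl : forall k, finite (fun n => dep n <= k)).
    { induction k as [|k [l Hl]].
      - exists [root]. intros n Hn. left. apply NNPP. intro H.
        assert (Hn' : n <> root) by auto. apply dep_par in Hn'. lia.
      - assert (Hl' : forall m : list nat, finite (fun n => In (par n) m /\ n <> root)).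
        { induction m as [|s m IHm]; [exists nil; intros n [[] _]|].
          eapply finite_mono; [|apply (finite_or _ _ (Hc s) IHm)].
          intros n [[E|Hn] Hr]; auto. left. split; auto. }
        eapply finite_mono; [|apply (finite_or _ _ (Hl' l) (finite_list [root]))].
        intros n Hn. destruct (Nat.eq_dec n root) as [->|Hr]; [right; now left|].
        left. split; auto. apply Hl. apply dep_par in Hr. lia. }
    destruct (Hl h) as [l Hl']. destruct (list_bound l) as [k Hk].
    specialize (Hk k (Hl' k (Hh k))). lia. }
  (* Minimising [h - dep p] maximises the depth of [p]. *)
  destruct (least_exists (fun j => exists p, infinite (child p) /\ h - dep p = j))
    as [j [[p [Hp Ej]] Hj]].
  { destruct He as [p Hp]. eauto. }
  exists p. split; auto. intros n Hn. apply not_infinite. intro Hi.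
  specialize (Hj (h - dep n) (ex_intro _ n (conj Hi eq_refl))).
  specialize (Hh n). lia.
Qed.

End Tree.

(** * Upper density *)

(** Upper density at least 1/2, without limit superior or division. *)
Definition half_dense (A : nat -> Prop) :=
  forall (eps : R) (N : nat), (0 < eps)%R ->
    exists n, N <= n /\ ((1 / 2 - eps) * INR n <= INR (count_upto A n))%R.

Lemma count_cover (A B : nat -> Prop) (k t : nat) :
  (forall n, k <= n -> A n \/ B n) -> t <= count_upto A t + count_upto B t + k.
Proof.
  intro H. induction t as [|t IH]; simpl; [lia|].
  destruct (excluded_middle_informative (A (S t))), (excluded_middle_informative (B (S t))); try lia.
  destruct (le_lt_dec k (S t)) as [Hk|Hk]; [|lia].
  destruct (H (S t) Hk); tauto.
Qed.

Lemma count_mono_beyond (A B : nat -> Prop) (k t : nat) :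
  (forall n, k <= n -> A n -> B n) -> count_upto A t <= count_upto B t + min k t.
Proof.
  intro H. induction t as [|t IH]; simpl count_upto; [lia|].
  destruct (excluded_middle_informative (A (S t))), (excluded_middle_informative (B (S t))); try lia.
  destruct (le_lt_dec k (S t)) as [Hk|Hk]; [|lia].
  specialize (H (S t) Hk). tauto.
Qed.

Lemma large_multiple (eps : R) (k : nat) :
  (0 < eps)%R -> exists M, forall n, M <= n -> (INR k <= eps * INR n)%R.
Proof.
  intro He. destruct (INR_unbounded (INR k / eps)) as [M HM]. exists M. intros n Hn.
  apply le_INR in Hn. apply Rmult_le_reg_l with (/ eps)%R; [now apply Rinv_0_lt_compat|].
  rewrite <- Rmult_assoc, Rinv_l, Rmult_1_l by lra. unfold Rdiv in HM. lra.
Qed.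

Lemma finite_bound (P : nat -> Prop) : finite P -> exists k, forall n, P n -> n < k.
Proof.
  intros [l Hl]. destruct (list_bound l) as [k Hk]. exists k. auto.
Qed.

(** If [A] fails, its share is below [1/2 - eA] for all large [n]; then [B] has the rest, up to an
    error [k <= eps * n]. *)
Lemma half_dense_or (A B : nat -> Prop) :
  finite (fun n => ~ A n /\ ~ B n) -> half_dense A \/ half_dense B.
Proof.
  intro Hf. destruct (finite_bound _ Hf) as [k Hk].
  destruct (classic (half_dense A)) as [|HA]; auto. right. intros eps N He.
  apply not_all_ex_not in HA. destruct HA as [eA HA].
  apply not_all_ex_not in HA. destruct HA as [NA HA].
  apply imply_to_and in HA. destruct HA as [HeA HA].
  destruct (large_multiple eps k He) as [M HM].
  exists (N + NA + M). split; [lia|].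
  set (n := N + NA + M) in *. specialize (HM n ltac:(unfold n; lia)).
  assert (H1 : (INR (count_upto A n) < (1 / 2 - eA) * INR n)%R).
  { apply Rnot_le_lt. intro. apply HA. exists n. split; auto. unfold n; lia. }
  assert (H2 : n <= count_upto A n + count_upto B n + k).
  { apply count_cover. intros m Hm. apply NNPP. intro. specialize (Hk m). lia || (
      assert (m < k) by (apply Hk; tauto); lia). }
  apply le_INR in H2. rewrite !plus_INR in H2.
  assert (0 <= INR n)%R by apply pos_INR. nra.
Qed.

Lemma half_dense_mono (A B : nat -> Prop) :
  half_dense A -> finite (fun n => A n /\ ~ B n) -> half_dense B.
Proof.
  intros HA Hf eps N He. destruct (finite_bound _ Hf) as [k Hk].
  destruct (large_multiple (eps / 2) k) as [M HM]; [lra|].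
  destruct (HA (eps / 2)%R (N + M)) as [n [Hn Hc]]; [lra|].
  exists n. split; [lia|]. specialize (HM n ltac:(lia)).
  assert (H : count_upto A n <= count_upto B n + min k n).
  { apply count_mono_beyond. intros m Hm HAm. apply NNPP. intro.
    assert (m < k) by (apply Hk; tauto). lia. }
  assert (H' : count_upto A n <= count_upto B n + k) by lia.
  apply le_INR in H'. rewrite plus_INR in H'. lra.
Qed.

Lemma half_dense_infinite (A : nat -> Prop) : half_dense A -> infinite A.
Proof.
  intro HA. apply NNPP. intro Hi. apply not_infinite in Hi.
  destruct (half_dense_mono A (fun _ => False) HA) with (eps := (1 / 4)%R) (N := 1)
    as [n [Hn Hc]]; [|lra|].
  - eapply finite_mono; [|exact Hi]. tauto.
  - assert (H0 : forall t, count_upto (fun _ => False) t = 0).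
    { induction t as [|t IH]; simpl; auto.
      destruct (excluded_middle_informative False); [tauto|lia]. }
    rewrite H0 in Hc. apply le_INR in Hn. simpl in Hc, Hn. lra.
Qed.

Lemma half_dense_subset (A B : nat -> Prop) :
  half_dense A -> (forall n, A n -> B n) -> half_dense B.
Proof.
  intros HA H. apply (half_dense_mono A); auto. exists nil. intros n [? Hn]. exfalso; auto.
Qed.

(** Tree copies use the vertices from 0 on, the complete graph those from 1 on; the successor map
    passes between them. *)
Lemma count_shift (A B : nat -> Prop) (n : nat) :
  (forall m, A m -> B (S m)) -> count_upto A n <= count_upto B (S n).
Proof.
  intro H. induction n as [|n IH]; [simpl; lia|].
  change (count_upto A (S n)) with
    (count_upto A n + (if excluded_middle_informative (A (S n)) then 1 else 0)).
  change (count_upto B (S (S n))) with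
    (count_upto B (S n) + (if excluded_middle_informative (B (S (S n))) then 1 else 0)).
  specialize (H (S n)). destruct (excluded_middle_informative (A (S n))),
      (excluded_middle_informative (B (S (S n)))); lia || tauto.
Qed.

Lemma half_dense_upper_density (A B : nat -> Prop) (eps : R) :
  half_dense A -> (forall m, A m -> B (S m)) -> (0 < eps)%R ->
  Rbar_le (Finite (1 / 2 - eps)) (upper_density B).
Proof.
  intros HA HAB He. unfold upper_density.
  set (u := fun n => (INR (count_upto B (S n)) / INR (S n))%R).
  apply Rbar_not_lt_le. intro Hlt.
  assert (HL : is_LimSup_seq u (LimSup_seq u)) by (unfold LimSup_seq; apply proj2_sig).
  (* Here [delta] is [eps] if the limit superior is finite, and 1/2 if it is minus infinity. *)
  assert (Hev : exists delta N, (0 < delta)%R /\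
     forall n, N <= n -> (u n < 1 / 2 - delta)%R).
  { destruct (LimSup_seq u) as [l| |]; simpl in Hlt, HL; [|tauto|].
    - assert (Hd : (0 < (1 / 2 - eps - l) )%R) by lra.
      destruct (HL (mkposreal _ Hd)) as [_ [N HN]]. exists eps, N. split; auto.
      intros n Hn. specialize (HN n Hn). simpl in HN. lra.
    - destruct (HL 0%R) as [N HN]. exists (1 / 2)%R, N. split; [lra|].
      intros n Hn. specialize (HN n Hn). lra. }
  destruct Hev as [delta [N [Hd HN]]].
  (* For such [n] the passage from [n] to [S n] costs less than the gap. *)
  destruct (large_multiple (delta / 2) 1) as [M HM]; [lra|].
  destruct (HA (delta / 2)%R (N + M)) as [n [Hn Hc]]; [lra|].
  specialize (HN n ltac:(lia)). specialize (HM n ltac:(lia)).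
  assert (H := count_shift A B n HAB). apply le_INR in H. unfold u in HN.
  assert (Hp : (0 < INR (S n))%R) by (apply lt_0_INR; lia).
  apply Rmult_lt_compat_r with (r := INR (S n)) in HN; auto.
  unfold Rdiv in HN. rewrite Rmult_assoc, Rinv_l, Rmult_1_r in HN by lra.
  rewrite S_INR in HN, Hp. simpl in HM. nra.
Qed.

(** * Choice of the colour and of the covered set *)

Theorem dense_tree_copy (c : nat -> nat -> bool) (root : nat) (par dep : nat -> nat) :
  (forall x y, c x y = c y x) -> dep root = 0 ->
  (forall n, n <> root -> dep n = S (dep (par n))) ->
  exists y C, tree_copy c root par y C /\ half_dense C.
Proof.
  intros Hc H0 Hp.
  assert (Hcores := cores_cofinite c).
  assert (Hcore := half_dense_or _ _ Hcores).
  destruct (classic (forall h, exists n, h <= dep n)) as [Hu|Hb].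
  { assert (HB : exists x, half_dense (core c x)) by (destruct Hcore; eauto).
    destruct HB as [x HB].
    destruct (robust_exists c Hc x _ (core_good c x)) as [z [D [HD [HR Hf]]]].
    assert (HDd : half_dense D) by (apply (half_dense_mono _ _ HB Hf)).
    destruct (half_dense_infinite D HDd nil) as [d [Hd _]].
    exists z, D. split; auto. now apply (copy_covering_robust c Hc root par dep H0 Hp z D d). }
  apply not_all_ex_not in Hb. destruct Hb as [h Hb].
  destruct (last_infinite_branching root par dep H0 Hp h) as [p [Hpi Hpf]].
  { intro n. destruct (le_lt_dec (dep n) h); auto. exfalso. apply Hb. exists n. lia. }
  destruct (classic (infinite (fun k => child root par p k /\ leaf root par k))) as [Hl|Hl].
  { assert (Ha : exists y a, core c y a /\ half_dense (fun m => c a m = y)).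
    { destruct Hcores as [L HL].
      set (S n := ~ In n L).
      (* If [S] is not good in colour [y], some [a] in [S] has finite [y]-degree. It lies in the
         other core, and its other neighbourhood is cofinite. *)
      assert (HS : forall y, good c y S \/
         exists a, core c (negb y) a /\ finite (fun m => c a m = y)).
      { intro y. destruct (classic (good c y S)) as [|Hg]; auto. right.
        apply not_all_ex_not in Hg. destruct Hg as [a Hg].
        apply imply_to_and in Hg. destruct Hg as [HSa Hi]. apply not_infinite in Hi.
        assert (Hf : finite (fun m => c a m = y)).
        { eapply finite_mono; [|apply (finite_or _ _ Hi (finite_list L))].
          intros m Hm. destruct (classic (In m L)); auto. }
        exists a. split; auto.
        assert (Hn : ~ core c y a).
        { intro Hy. destruct Hf as [l Hl'].
          destruct (core_good c y a Hy l) as [m [[_ Hm] Hml]]. auto. }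
        apply NNPP. intro Hn'. apply HSa, HL. destruct y; auto. }
      assert (Hneg : forall y a, finite (fun m => c a m = y) ->
        half_dense (fun m => c a m = negb y)).
      { intros y a Hf. destruct (half_dense_or (fun m => c a m = negb y) (fun _ => False)); auto.
        - eapply finite_mono; [|exact Hf]. intros m [Hm _]. destruct (c a m), y; simpl in *; tauto.
        - exfalso. destruct (half_dense_infinite _ H nil) as [n [[] _]]. }
      destruct (HS true) as [Gt|[a [? ?]]]; [|exists (negb true), a; auto].
      destruct (HS false) as [Gf|[a [? ?]]]; [|exists (negb false), a; auto].
      (* Now [S] is good in both colours, so any [a] in [S] lies in both cores and its larger
         neighbourhood serves. *)
      destruct (list_bound L) as [a Ha].
      assert (HSa : S a). { intro Hi. apply Ha in Hi. lia. }
      destruct (half_dense_or (fun m => c a m = true) (fun m => c a m = false)).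
      - exists nil. intros m [H1 H2]. destruct (c a m); tauto.
      - exists true, a. split; auto. exists S; auto.
      - exists false, a. split; auto. exists S; auto. }
    destruct Ha as [y [a [Ha Hd]]]. exists y, (fun m => c a m = y). split; auto.
    apply (copy_covering_star c Hc root par dep H0 Hp y (core c y) p a); auto.
    apply core_good. }
  assert (Hnl := infinite_split _ _ Hpi Hl). cbv beta in Hnl.
  assert (cover : forall y D Y A a, good c y D -> D a -> Y a -> half_dense Y -> infinite A ->
     (forall v, Y v -> finite (fun b => A b /\ c v b <> y)) ->
     exists y C, tree_copy c root par y C /\ half_dense C).
  { intros y D Y A a HD HDa HYa HY HA HYA. exists y, Y. split; auto.
    apply (copy_covering_bipartite c Hc root par dep H0 Hp y D Y A p a); auto.
    now apply half_dense_infinite. }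
  (* The class of the colour of [A] is good and contains [A], so [p] can be sent to a vertex of
     [A]. *)
  assert (cover_own : forall A chi x, cohesive c A chi x -> half_dense (fun v => chi v = x) ->
     exists y C, tree_copy c root par y C /\ half_dense C).
  { intros A chi x HA HX.
    assert (HG := cohesive_class_good c A chi x (fun _ => True) HA (fun _ _ => I)).
    destruct (HA) as [Hi [Hx Hf]]. destruct (Hi nil) as [a [Ha _]].
    apply (cover x (fun v => chi v = x /\ True) (fun v => chi v = x) A a); auto.
    intros v <-. apply Hf. }
  (* One of the two classes is half dense; if it is the class of [negb x], send [p] to [a]. *)
  assert (cover_other : forall A chi x a, cohesive c A chi x -> chi a = negb x ->
     core c (negb x) a -> exists y C, tree_copy c root par y C /\ half_dense C).
  { intros A chi x a HA Ha Hca.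
    destruct (half_dense_or (fun v => chi v = x) (fun v => chi v = negb x)) as [HX|HY].
    - exists nil. intros m [H1 H2]. destruct (chi m), x; tauto.
    - now apply (cover_own A chi x).
    - destruct HA as [Hi [_ Hf]].
      apply (cover (negb x) (core c (negb x)) (fun v => chi v = negb x) A a); auto.
      + apply core_good.
      + intros v <-. apply Hf. }
  (* Either a copy is found, or some class of colour [y], with its [A] inside, contains the core of
     the other colour. *)
  assert (Hside : forall y, (exists y C, tree_copy c root par y C /\ half_dense C) \/
     exists A chi, cohesive c A chi y /\ forall v, core c (negb y) v -> chi v = y).
  { intro y. destruct (classic (exists a, core c y a)) as [[a Ha]|Hne].
    - destruct (cohesive_exists c (fun u => c a u = y)) as [A [chi [x [HA HS]]]].
      { eapply infinite_mono; [|apply (core_good c y a Ha)]. tauto. }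
      (* [A] was chosen inside the [y]-neighbourhood of [a]. *)
      assert (Hchi : chi a = y).
      { destruct HA as [Hi [_ Hf]].
        destruct (infinite_remove A (fun b => c a b = chi a) Hi (Hf a) nil) as [b [[HAb E] _]].
        rewrite <- E. auto. }
      destruct (bool_dec x y) as [->|Hxy].
      + destruct (classic (forall v, core c (negb y) v -> chi v = y)) as [Hv|Hv].
        { right. exists A, chi; auto. }
        left. apply not_all_ex_not in Hv. destruct Hv as [v Hv].
        apply imply_to_and in Hv. destruct Hv as [Hv Hne].
        apply (cover_other A chi y v); auto. destruct (chi v), y; tauto.
      + left. assert (y = negb x) as -> by (destruct x, y; tauto).
        now apply (cover_other A chi x a).
    - left. destruct (core_empty c y) as [A [L [HA HL]]]; [intros v Hv; apply Hne; eauto|].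
      set (Y v := ~ In v L).
      assert (HYd : half_dense Y).
      { destruct (half_dense_or Y (fun _ => False)) as [HY|HN]; auto.
        - exists L. intros m [Hm _]. apply NNPP. exact Hm.
        - exfalso. destruct (half_dense_infinite _ HN nil) as [n [[] _]]. }
      assert (HAY : infinite (fun a => A a /\ Y a)).
      { apply infinite_remove; auto. exists L. intros m [_ Hm]. apply NNPP. exact Hm. }
      destruct (HAY nil) as [a [[_ Ha] _]].
      apply (cover (negb y) Y Y A a); auto.
      intros v Hv. eapply infinite_mono;
        [|apply (infinite_remove _ (fun b => c v b = negb y) HAY)].
      + tauto.
      + eapply finite_mono; [|apply (HL v Hv)]. tauto. }
  destruct (Hside true) as [|[A1 [chi1 [HA1 H1]]]]; auto.
  destruct (Hside false) as [|[A2 [chi2 [HA2 H2]]]]; auto.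
  (* The half-dense core lies in a class of the opposite colour to which [cover_own] applies. *)
  destruct Hcore as [Ht|Hf].
  - apply (cover_own A2 chi2 false); auto. now apply (half_dense_subset (core c true)).
  - apply (cover_own A1 chi1 true); auto. now apply (half_dense_subset (core c false)).
Qed.

(** * Rooting a forest *)

Fixpoint walk (adj : nat -> nat -> Prop) (n u v : nat) : Prop :=
  match n with
  | 0 => u = v
  | S k => exists w, walk adj k u w /\ adj w v
  end.

Lemma connected_walk adj u v : clos_refl_trans nat adj u v -> exists n, walk adj n u v.
Proof.
  intro H. apply clos_rt_rtn1 in H. induction H as [|w v Ha _ [n Hn]].
  - now exists 0.
  - exists (S n), w. auto.
Qed.

Lemma connected_sym (adj : nat -> nat -> Prop) u v :
  (forall x y, adj x y -> adj y x) ->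
  clos_refl_trans nat adj u v -> clos_refl_trans nat adj v u.
Proof.
  intros Hs H. induction H; [apply rt_step; auto|apply rt_refl|eapply rt_trans; eauto].
Qed.

Lemma connected_mono {V : Type} (R R' : V -> V -> Prop) u v :
  (forall x y, R x y -> R' x y) -> clos_refl_trans V R u v -> clos_refl_trans V R' u v.
Proof.
  intros HR H. induction H; [apply rt_step; auto|apply rt_refl|eapply rt_trans; eauto].
Qed.

(** A simple path from [u] to [v] avoiding this edge has at least two steps, so the edge closes it
    to a cycle. *)
Lemma cycle_of_detour {V : Type} (adj : V -> V -> Prop) u v :
  is_simple_graph adj -> adj u v ->
  clos_refl_trans V (fun s t => adj s t /\ ~ (s = u /\ t = v)) u v -> has_cycle adj.
Proof.
  intros [Hs Hi] Ha H. destruct (simple_path _ _ _ H) as [l [H1 [H2 H3]]].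
  exists u, l. split; [|split; [auto|split]].
  - destruct l as [|x [|x' l]]; simpl in *; [|subst x; tauto|lia].
    subst v. now apply Hi in Ha.
  - assert (Hw : forall w, path_adj (fun s t => adj s t /\ ~ (s = u /\ t = v)) w l ->
      path_adj adj w l); [|auto].
    clear. induction l as [|x l IH]; simpl; auto. intros w [[? _] ?]. auto.
  - rewrite H3. auto.
Qed.

(* Components are joined by making all their roots children of [root]. *)
Lemma forest_in_tree (adj : nat -> nat -> Prop) :
  is_forest adj ->
  exists root par dep, dep root = 0 /\
    (forall n, n <> root -> dep n = S (dep (par n))) /\
    forall u v, adj u v -> (u <> root /\ par u = v) \/ (v <> root /\ par v = u).
Proof.
  intros [Hg Hc]. destruct (Hg) as [Hs Hi].
  set (E := clos_refl_trans nat adj).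
  assert (Es : forall u v, E u v -> E v u) by (intros; now apply connected_sym).
  destruct (choice_fun (fun v r => E v r /\ forall m, E v m -> r <= m)) as [rep Hrep].
  { intro v. apply least_exists. exists v. apply rt_refl. }
  assert (Hrepe : forall u v, E u v -> rep u = rep v).
  { intros u v H. destruct (Hrep u) as [H1 H2], (Hrep v) as [H3 H4].
    apply Nat.le_antisymm.
    - apply H2, rt_trans with v; auto.
    - apply H4, rt_trans with u; auto. apply Es, H. }
  destruct (choice_fun (fun v d => walk adj d (rep v) v /\
     forall m, walk adj m (rep v) v -> d <= m)) as [dist Hdist].
  { intro v. apply least_exists. apply connected_walk, Es, Hrep. }
  (* The parent is the last vertex but one of a shortest walk from the least vertex of the
     component. *)
  assert (Hpar : forall v, exists u, v <> rep v ->
     adj u v /\ rep u = rep v /\ dist v = S (dist u)).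
  { intro v. destruct (Nat.eq_dec v (rep v)) as [Hv|Hv]; [exists 0; tauto|].
    destruct (Hdist v) as [H1 H2]. destruct (dist v) as [|d] eqn:Ed.
    { simpl in H1. congruence. }
    destruct H1 as [u [Hw Ha]]. exists u. intros _.
    assert (Hr : rep u = rep v) by (apply Hrepe, rt_step, Ha).
    repeat split; auto. f_equal. destruct (Hdist u) as [H3 H4]. rewrite Hr in H3, H4.
    apply Nat.le_antisymm; [|now apply H4].
    apply le_S_n, H2. exists u; auto. }
  destruct (choice_fun _ Hpar) as [par0 Hp].
  set (root := rep 0).
  assert (Hroot : rep root = root). { symmetry. apply Hrepe, Hrep. }
  assert (Hd0 : forall v, v = rep v -> dist v = 0).
  { intros v Hv. destruct (Hdist v) as [_ H]. specialize (H 0). simpl in H.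
    assert (dist v <= 0) by auto. lia. }
  set (par v := if Nat.eq_dec v (rep v) then root else par0 v).
  (* The other components hang one level below [root]. *)
  set (dep v := if Nat.eq_dec (rep v) root then dist v else S (dist v)).
  exists root, par, dep. split; [|split].
  - unfold dep. destruct (Nat.eq_dec _ _); [|contradiction]. now apply Hd0.
  - intros n Hn. unfold par. destruct (Nat.eq_dec n (rep n)) as [E1|E1].
    + unfold dep. rewrite <- E1, Hroot. destruct (Nat.eq_dec n root); [contradiction|].
      destruct (Nat.eq_dec root root); [|contradiction]. rewrite !Hd0; auto.
    + destruct (Hp n E1) as [_ [H1 H2]]. unfold dep. rewrite H1, H2.
      destruct (Nat.eq_dec (rep n) root); auto.
  - intros u v Ha. apply NNPP. intro Hno. apply Hc.
    apply (cycle_of_detour adj u v Hg Ha).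
    (* If [uv] is no parent edge, going up from [u] to the representative and down to [v] avoids it,
       which yields a cycle. Both directions are excluded to keep [R] symmetric. *)
    set (R s t := adj s t /\ ~ (s = u /\ t = v) /\ ~ (s = v /\ t = u)).
    assert (HR : forall d w, dist w = d -> clos_refl_trans nat R (rep w) w).
    { induction d as [|d IH]; intros w Hw.
      - destruct (Hdist w) as [H _]. rewrite Hw in H. simpl in H. rewrite H. apply rt_refl.
      - destruct (Nat.eq_dec w (rep w)) as [E1|E1]; [rewrite <- E1; apply rt_refl|].
        destruct (Hp w E1) as [H1 [H2 H3]]. rewrite <- H2.
        apply rt_trans with (par0 w); [apply IH; lia|]. apply rt_step.
        assert (Hw1 : w <> root) by congruence.
        assert (Hw2 : par w = par0 w).
        { unfold par. destruct (Nat.eq_dec w (rep w)); congruence. }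
        split; auto. split; intros [? ?]; apply Hno; [right|left]; split; congruence. }
    assert (HRs : clos_refl_trans nat R u v).
    { apply rt_trans with (rep u).
      - apply connected_sym; [|now apply (HR (dist u))].
        intros x y [? [? ?]]. repeat split; auto; tauto.
      - rewrite (Hrepe u v) by now apply rt_step. now apply (HR (dist v)). }
    apply (connected_mono R); auto. intros x y [? [? ?]]. split; auto.
Qed.

Lemma forest_pullback {V : Type} (adj : V -> V -> Prop) (g : nat -> V) :
  (forall m n, g m = g n -> m = n) -> is_forest adj ->
  is_forest (fun m n => adj (g m) (g n)).
Proof.
  intros Hg [[Hs Hi] Hc]. split; [split; auto|].
  intros [v [l [H1 [H2 [H3 H4]]]]]. apply Hc. exists (g v), (map g l).
  split; [now rewrite length_map|]. split; [|split].
  - change (NoDup (map g (v :: l))). apply Injective_map_NoDup; auto.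
  - clear - H3. revert v H3. induction l as [|x l IH]; simpl; auto. intros v [? ?]. auto.
  - replace (last (map g l) (g v)) with (g (last l v)); auto.
    clear. revert v. induction l as [|x l IH]; intro v; auto.
    simpl map. now rewrite !last_cons.
Qed.

(** * Transfer from the rooted tree to the given forest *)

Open Scope R_scope.

Theorem mainTheorem5 (V : Type) (adj : V -> V -> Prop)
    (HV : countably_infinite V) (HT : is_forest adj)
    (c : nat -> nat -> bool) (Hc : symmetric_colouring c)
    (eps : R) (Heps : 0 < eps) :
  exists (b : bool) (f : V -> nat),
    mono_copy adj c b f /\
    Rbar_le (Finite (1 / 2 - eps)) (upper_density (image_set f)).
Proof.
  destruct HV as [g [Hg Hsurj]].
  destruct (forest_in_tree _ (forest_pullback adj g Hg HT)) as [root [par [dep [H0 [Hp He]]]]].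
  (* The shifted colouring turns vertices from 0 on into vertices from 1 on. *)
  destruct (dense_tree_copy (fun x y => c (S x) (S y)) root par dep) as [b [C [[f [Hi [Hf HC]]] Hd]]];
    auto.
  destruct (choice_fun _ Hsurj) as [h Hh].
  exists b, (fun v => S (f (h v))). split; [split; [|split]|].
  - intros u v E. injection E as E. apply Hi in E. rewrite <- (Hh u), <- (Hh v). congruence.
  - intro v. lia.
  - intros u v Huv. rewrite <- (Hh u), <- (Hh v) in Huv.
    destruct (He _ _ Huv) as [[Hr <-]|[Hr <-]]; [|rewrite Hc]; apply Hf; auto.
  - apply (half_dense_upper_density C); auto.
    intros m Hm. destruct (HC m Hm) as [n Hn]. exists (g n). f_equal.
    replace (h (g n)) with n; auto.
Qed.
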